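(* Fix $a\in\mathbb{Q}^\times$, let $E_a$ be the elliptic curve $Y^2=X^3+4X^2+16a^2$ over $\mathbb{Q}$ with point at infinity $\mathcal{O}$, and for $b\in\mathbb{Q}$ let $f_{b,a}(x)=x^3+bx+a$. There is a bijection between (1) rational points $Q\in E_a(\mathbb{Q})\setminus\{\mathcal{O}\}$ that can be written $Q=(X,Y)$ with $X\neq0$ and $Y\neq0$, and (2) ordered triples $(b,x_1,x_2)\in\mathbb{Q}^3$ such that $x_1\neq x_2$, $f_{b,a}(x_1)=x_2$ and $f_{b,a}(x_2)=x_1$. The forward map (from (1) to (2)) is $$b=-\frac{X}{4}-2-\frac{16a^2}{X^2},\qquad x_1=\frac{-4a-Y}{2X},\qquad x_2=\frac{-4a+Y}{2X},$$ and the inverse map is $$(b,x_1,x_2)\longmapsto (X,Y)=\left(-\frac{4a}{x_1+x_2},\ \frac{4a(x_1-x_2)}{x_1+x_2}\right).$$ *)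

(* Defs.v *)
From HB Require Import structures.
From mathcomp Require Import all_boot all_order all_algebra.
From mathcomp Require Import ring lra.

Set Implicit Arguments.
Unset Strict Implicit.
Unset Printing Implicit Defensive.

Import Order.TTheory GRing.Theory Num.Theory.
Local Open Scope ring_scope.

(* General Weierstrass equation
     Y^2 + a1 X Y + a3 Y = X^3 + a2 X^2 + a4 X + a6. *)
Record weierstrass (K : fieldType) := Weierstrass {
  wa1 : K; wa2 : K; wa3 : K; wa4 : K; wa6 : K }.

Definition discriminant (K : fieldType) (W : weierstrass K) : K :=
  let b2 := wa1 W ^+ 2 + 4 * wa2 W in
  let b4 := 2 * wa4 W + wa1 W * wa3 W in
  let b6 := wa3 W ^+ 2 + 4 * wa6 W in
  let b8 := wa1 W ^+ 2 * wa6 W + 4 * wa2 W * wa6 W - wa1 W * wa3 W * wa4 W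
            + wa2 W * wa3 W ^+ 2 - wa4 W ^+ 2 in
  - b2 ^+ 2 * b8 - 8 * b4 ^+ 3 - 27 * b6 ^+ 2 + 9 * b2 * b4 * b6.

Record ellipticCurve (K : fieldType) := EllipticCurve {
  ec_eqn :> weierstrass K;
  ec_smooth : discriminant ec_eqn != 0 }.

(* The line at infinity meets a Weierstrass cubic in a single point, which is
   K-rational: [Infinity]. *)
Inductive point (K : fieldType) := Infinity | Affine of K & K.
Arguments Infinity {K}.

Definition oncurve (K : fieldType) (W : weierstrass K) (P : point K) : bool :=
  match P with
  | Infinity => true
  | Affine X Y =>
      Y ^+ 2 + wa1 W * X * Y + wa3 W * Y
      == X ^+ 3 + wa2 W * X ^+ 2 + wa4 W * X + wa6 W
  end.

Definition ecPoint (K : fieldType) (E : ellipticCurve K) :=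
  {P : point K | oncurve E P}.

Definition Ea_eqn (a : rat) : weierstrass rat :=
  Weierstrass 0 4 0 0 (16 * a ^+ 2).

Lemma Ea_discriminant (a : rat) :
  discriminant (Ea_eqn a) = - (2 ^+ 12 * a ^+ 2 * (16 + 27 * a ^+ 2)).
Proof.
have gen (K : fieldType) (x : K) :
    discriminant (Weierstrass 0 4 0 0 (16 * x ^+ 2))
    = - (2 ^+ 12 * x ^+ 2 * (16 + 27 * x ^+ 2)).
  by rewrite /discriminant; cbn [wa1 wa2 wa3 wa4 wa6]; ring.
exact: gen.
Qed.

Lemma Ea_smooth (a : rat) : a != 0 -> discriminant (Ea_eqn a) != 0.
Proof.
move=> a0; rewrite Ea_discriminant oppr_eq0.
have gen (K : realFieldType) (x : K) :
    x != 0 -> 2 ^+ 12 * x ^+ 2 * (16 + 27 * x ^+ 2) != 0.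
  move=> x0; have x2 : 0 < x ^+ 2 by rewrite exprn_even_gt0.
  apply: mulf_neq0; last by apply: lt0r_neq0; lra.
  by apply: mulf_neq0; [rewrite expf_neq0 // pnatr_eq0 | rewrite expf_neq0].
exact: gen.
Qed.

Definition Ea (a : rat) (ha : a != 0) : ellipticCurve rat :=
  EllipticCurve (Ea_smooth ha).

Definition f (b a x : rat) : rat := x ^+ 3 + b * x + a.

Definition nonzero_coords (P : point rat) : bool :=
  match P with
  | Infinity => false
  | Affine X Y => (X != 0) && (Y != 0)
  end.

Definition curve_points (a : rat) (ha : a != 0) :=
  {Q : ecPoint (Ea ha) | nonzero_coords (val Q)}.

Definition is_two_cycle (a : rat) (t : rat * rat * rat) : bool :=
  let: (b, x1, x2) := t in [&& x1 != x2, f b a x1 == x2 & f b a x2 == x1].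

Definition two_cycles (a : rat) := {t : rat * rat * rat | is_two_cycle a t}.

(* Main.v *)
Require Import Defs.
From HB Require Import structures.
From mathcomp Require Import all_boot all_order all_algebra.
From mathcomp Require Import ring.

Set Implicit Arguments.
Unset Strict Implicit.
Unset Printing Implicit Defensive.

Import Order.TTheory GRing.Theory Num.Theory.
Local Open Scope ring_scope.

(** Let [s = x1 + x2] and [p = x1 * x2].  Subtracting the two equations of a
    2-cycle and cancelling [x1 - x2] gives [b = p - s^2 - 1]; adding them then
    gives [p * s = a - s].  Hence [s != 0] because [a != 0], and [b] and [p] are
    determined by [s].  With [X = -4a/s] and [Y = -X(x1 - x2)], the
    discriminant identity [(x1 - x2)^2 = s^2 - 4p] becomes the equation of the
    curve. *)

Section CycleAlgebra.

Variable K : realFieldType.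
Implicit Types a b x X Y : K.

Definition cycle_of_coords a X Y : K * K * K :=
  (- (X / 4) - 2 - 16 * a ^+ 2 / X ^+ 2,
   (- (4 * a) - Y) / (2 * X), (- (4 * a) + Y) / (2 * X)).

Definition coords_of_cycle a (t : K * K * K) : K * K :=
  let: (_, x1, x2) := t in
  (- (4 * a / (x1 + x2)), 4 * a * (x1 - x2) / (x1 + x2)).

Lemma cycle_of_coords_step a X Y : X != 0 ->
    Y ^+ 2 = X ^+ 3 + 4 * X ^+ 2 + 16 * a ^+ 2 ->
  let x1 := (- (4 * a) - Y) / (2 * X) in
  x1 ^+ 3 + (- (X / 4) - 2 - 16 * a ^+ 2 / X ^+ 2) * x1 + a
  = (- (4 * a) + Y) / (2 * X).
Proof.
move=> X0 e x1; apply/eqP; rewrite -subr_eq0; apply/eqP.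
(* The defect of the cycle equation is a cubic in [Y]. Dividing it by the curve polynomial,
   quadratic in [Y], leaves no remainder, and this is the quotient. *)
transitivity (- (Y + 12 * a) / (8 * X ^+ 3)
              * (Y ^+ 2 - (X ^+ 3 + 4 * X ^+ 2 + 16 * a ^+ 2))).
  by rewrite /x1; field.
by rewrite e subrr mulr0.
Qed.

Lemma cycle_of_coordsP a X Y : X != 0 -> Y != 0 ->
    Y ^+ 2 = X ^+ 3 + 4 * X ^+ 2 + 16 * a ^+ 2 ->
  let: (b, x1, x2) := cycle_of_coords a X Y in
  [/\ x1 != x2, x1 ^+ 3 + b * x1 + a = x2 & x2 ^+ 3 + b * x2 + a = x1].
Proof.
move=> X0 Y0 e; rewrite /cycle_of_coords; split.
- rewrite -subr_eq0.
  have -> : (- (4 * a) - Y) / (2 * X) - (- (4 * a) + Y) / (2 * X) = - (Y / X).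
    by field.
  by rewrite oppr_eq0 mulf_neq0 ?invr_eq0.
- exact: cycle_of_coords_step.
(* The reflection [Y] to [- Y] preserves the curve, fixes [b] and swaps [x1] with [x2]. *)
- have := @cycle_of_coords_step a X (- Y) X0.
  by rewrite sqrrN opprK; apply.
Qed.

Section TwoCycle.

Variables (a b x1 x2 : K).
Hypotheses (a0 : a != 0) (x12 : x1 != x2).
Hypotheses (e1 : x1 ^+ 3 + b * x1 + a = x2) (e2 : x2 ^+ 3 + b * x2 + a = x1).

Lemma cycle_coef : b = x1 * x2 - (x1 + x2) ^+ 2 - 1.
Proof.
have d0 : x1 - x2 != 0 by rewrite subr_eq0.
apply: (mulfI d0); apply/eqP; rewrite -subr_eq0; apply/eqP.
transitivity ((x1 ^+ 3 + b * x1 + a - x2) - (x2 ^+ 3 + b * x2 + a - x1)).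
  by ring.
by rewrite e1 e2 !subrr.
Qed.

Lemma cycle_prod_sum : x1 * x2 * (x1 + x2) = a - (x1 + x2).
Proof.
have two0 : 2 != 0 :> K by rewrite pnatr_eq0.
apply: (mulfI two0); apply/eqP; rewrite -subr_eq0; apply/eqP.
(* Once [b] is eliminated, the sum of the two defects is [2 * (a - s - p * s)]; hence the factor 2
   introduced above. *)
transitivity (- ((x1 ^+ 3 + b * x1 + a - x2) + (x2 ^+ 3 + b * x2 + a - x1))).
  by rewrite cycle_coef; ring.
by rewrite e1 e2 !subrr addr0 oppr0.
Qed.

Lemma cycle_sum_neq0 : x1 + x2 != 0.
Proof.
by apply: contra_neq a0 => s0; have := cycle_prod_sum; rewrite s0 mulr0 subr0.
Qed.

Lemma coords_of_cycleP :
  let: (X, Y) := coords_of_cycle a (b, x1, x2) in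
  [/\ X != 0, Y != 0 & Y ^+ 2 = X ^+ 3 + 4 * X ^+ 2 + 16 * a ^+ 2].
Proof.
have s0 := cycle_sum_neq0.
have a4 : 4 * a != 0 by rewrite mulf_neq0 ?pnatr_eq0.
rewrite /coords_of_cycle; split.
- by rewrite oppr_eq0 mulf_neq0 ?invr_eq0.
- by rewrite mulf_neq0 ?invr_eq0 // mulf_neq0 ?subr_eq0.
apply/eqP; rewrite -subr_eq0; apply/eqP.
(* Expanding [(x1 - x2) ^+ 2] as [s ^+ 2 - 4 * p] cancels the terms [16 * a ^+ 2]; what is left is
   this multiple of the relation [p * s = a - s]. *)
transitivity (- 64 * a ^+ 2 / (x1 + x2) ^+ 3
              * (x1 * x2 * (x1 + x2) - (a - (x1 + x2)))); first by field.
by rewrite cycle_prod_sum subrr mulr0.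
Qed.

Lemma coords_of_cycleK :
  let: (X, Y) := coords_of_cycle a (b, x1, x2) in
  cycle_of_coords a X Y = (b, x1, x2).
Proof.
have s0 := cycle_sum_neq0.
rewrite /coords_of_cycle /cycle_of_coords; congr (_, _, _).
(* At [X = - (4 * a / s)] the formula for [b] becomes [a / s - 2 - s ^+ 2], which agrees with
   [p - s ^+ 2 - 1] because [p = a / s - 1]. *)
- rewrite cycle_coef; apply/eqP; rewrite -subr_eq0; apply/eqP.
  transitivity (- (x1 * x2 * (x1 + x2) - (a - (x1 + x2))) / (x1 + x2)).
    by field; rewrite s0 a0.
  by rewrite cycle_prod_sum subrr oppr0 mul0r.
(* The remaining two entries simplify to [(s + (x1 - x2)) / 2] and [(s - (x1 - x2)) / 2]. *)
- by field; rewrite s0 a0.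
- by field; rewrite s0 a0.
Qed.

End TwoCycle.

Lemma cycle_of_coordsK a X Y : a != 0 -> X != 0 ->
  coords_of_cycle a (cycle_of_coords a X Y) = (X, Y).
Proof.
move=> a0 X0; rewrite /cycle_of_coords /coords_of_cycle.
(* With the sum in closed form, the denominators visibly vanish only if [a] or [X] does. *)
have -> : (- (4 * a) - Y) / (2 * X) + (- (4 * a) + Y) / (2 * X)
          = - (4 * a / X) by field.
by congr (_, _); field; rewrite X0 a0.
Qed.

End CycleAlgebra.

Lemma oncurve_Ea (a X Y : rat) :
  oncurve (Ea_eqn a) (Affine X Y)
  = (Y ^+ 2 == X ^+ 3 + 4 * X ^+ 2 + 16 * a ^+ 2).
Proof. by rewrite /= !mul0r !addr0. Qed.

Lemma is_two_cycleP (a b x1 x2 : rat) :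
  reflect [/\ x1 != x2, x1 ^+ 3 + b * x1 + a = x2 & x2 ^+ 3 + b * x2 + a = x1]
          (is_two_cycle a (b, x1, x2)).
Proof.
by apply: (iffP and3P) => -[x12 e1 e2]; split=> //; apply/eqP.
Qed.

(** The value at [Infinity] is a dummy: [nonzero_coords] excludes that point. *)
Definition cycle_of_point (a : rat) (P : point rat) : rat * rat * rat :=
  if P is Affine X Y then cycle_of_coords a X Y else (0, 0, 0).

Definition point_of_cycle (a : rat) (t : rat * rat * rat) : point rat :=
  let: (X, Y) := coords_of_cycle a t in Affine X Y.

Lemma cycle_of_pointP (a : rat) (P : point rat) :
  oncurve (Ea_eqn a) P -> nonzero_coords P ->
  is_two_cycle a (cycle_of_point a P).
Proof.
case: P => [|X Y] //; rewrite oncurve_Ea => /eqP e /andP[X0 Y0].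
exact/is_two_cycleP/(cycle_of_coordsP X0 Y0 e).
Qed.

Lemma point_of_cycleP (a : rat) (t : rat * rat * rat) :
  a != 0 -> is_two_cycle a t ->
  oncurve (Ea_eqn a) (point_of_cycle a t) /\
  nonzero_coords (point_of_cycle a t).
Proof.
case: t => [[b x1] x2] a0 /is_two_cycleP[x12 e1 e2].
have [X0 Y0 e] := coords_of_cycleP a0 x12 e1 e2.
rewrite /point_of_cycle /coords_of_cycle oncurve_Ea e eqxx.
by split=> //; apply/andP.
Qed.

Lemma cycle_of_pointK (a : rat) (P : point rat) :
  a != 0 -> nonzero_coords P -> point_of_cycle a (cycle_of_point a P) = P.
Proof.
case: P => [|X Y] // a0 /andP[X0 _].
by rewrite /point_of_cycle /cycle_of_point cycle_of_coordsK.
Qed.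

Lemma point_of_cycleK (a : rat) (t : rat * rat * rat) :
  a != 0 -> is_two_cycle a t -> cycle_of_point a (point_of_cycle a t) = t.
Proof.
case: t => [[b x1] x2] a0 /is_two_cycleP[x12 e1 e2].
exact: coords_of_cycleK a0 x12 e1 e2.
Qed.

Theorem theorem3p1 (a : rat) (ha : a != 0) :
  exists (F : curve_points ha -> two_cycles a)
         (G : two_cycles a -> curve_points ha),
    [/\ cancel F G,
        cancel G F,
        (forall (Q : curve_points ha) (X Y : rat),
           val (val Q) = Affine X Y ->
           val (F Q) = (- (X / 4) - 2 - 16 * a ^+ 2 / X ^+ 2,
                        (- (4 * a) - Y) / (2 * X),
                        (- (4 * a) + Y) / (2 * X)))
      & (forall (t : two_cycles a) (b x1 x2 : rat),
           val t = (b, x1, x2) ->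
           val (val (G t)) = Affine (- (4 * a / (x1 + x2)))
                                    (4 * a * (x1 - x2) / (x1 + x2)))].
Proof.
pose F (Q : curve_points ha) : two_cycles a :=
  exist (is_two_cycle a) _ (cycle_of_pointP (valP (val Q)) (valP Q)).
pose G (t : two_cycles a) : curve_points ha :=
  let: conj onE nz := point_of_cycleP ha (valP t) in
  exist (fun Q : ecPoint (Ea ha) => nonzero_coords (val Q))
        (exist (oncurve (Ea ha)) (point_of_cycle a (val t)) onE) nz.
(* [G t] is stuck on the opaque conjunction it matches on; destructing that proof exposes the
   underlying point. *)
have valG t : val (val (G t)) = point_of_cycle a (val t).
  by rewrite /G; case: point_of_cycleP.
exists F, G; split.
(* Both subtypes are cut out by boolean predicates, so it suffices to compare the underlying
   points. *)
- move=> Q; apply/val_inj/val_inj; rewrite valG.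
  exact: cycle_of_pointK ha (valP Q).
- move=> t; apply: val_inj; rewrite [LHS]/= valG.
  exact: point_of_cycleK ha (valP t).
- by move=> Q X Y eQ; rewrite [LHS]/= [sval _]eQ.
- by move=> t b x1 x2 et; rewrite valG et.
Qed.
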